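(* Let $a$ be a complete clique in an edge-colored graph. The following are equivalent: (1) $a$ is Gallai, i.e., has no colorful triangle; (2) $a$ has no colorful cycle (of any length); (3) $a$ is a hereditary $2$-clique; (4) $a$ is a hereditarily irreducible $2$-clique; (5) $a$ is a tree $2$-clique; (6) for all disjoint subcliques $b,c$ of $a$, $|\overline{bc}\setminus\overline{bb}|\le |c|$; (7) for every subclique $b$ of $a$, $|\overline{bb}|\le |b|-1$.
   Context: A clique is a complete subgraph induced by a nonempty vertex set, with the restricted edge coloring; subcliques are nonempty. For cliques $b,c$, $\overline{bc}$ is the set of colors of edges $uv$ with $u\in b$, $v\in c$ ($\overline{bb}=\emptyset$ if $|b|=1$). An $n$-cycle is a sequence of $n\ge2$ distinct vertices $(v_1,\dots,v_n)$ with edges $v_iv_{i+1}$ (indices mod $n$); it is colorful if its edges have pairwise distinct colors; triangles are 3-cycles. A partition of a clique into nonempty disjoint subcliques is a $2$-partition if the edges joining distinct blocks use at most two colors in total; it is homogeneous if for any two distinct blocks all edges between them have the same color; it is nontrivial if it has at least two blocks and not all blocks are singletons. Hereditary $2$-cliques (least class): singletons, and any clique admitting a homogeneous $2$-partition into hereditary $2$-cliques. A tree is a finite poset in which every pair of unrelated elements has a common upper bound but no common lower bound; parent/child is the covering relation, siblings are unrelated elements with a common parent, leaves are elements with no children. The sibling graph $S(T)$ has vertex set $T$ and edges between siblings; a coloring $\widehat{\bullet}$ of it is a $2$-coloring if for each non-leaf $t$ the edges among the children of $t$ use at most two colors. The leaf graph $K(T)$ is the complete graph on the leaves colored by $\overline{st}=\widehat{uv}$,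 $u,v$ the siblings with $s\le u$, $t\le v$. A clique is a tree $2$-clique if there are a tree $T$, a $2$-coloring of $S(T)$ and a color-preserving bijection from the clique onto $K(T)$. The factor at a non-leaf $t$ is the set of children of $t$ colored by $\widehat{\bullet}$; a clique is irreducible if it has no nontrivial homogeneous partition; a hereditarily irreducible $2$-clique is one representable as a tree $2$-clique with all factors irreducible.
   Formalization: The clique a is taken to be finite: an infinite one-colored clique is Gallai but is not a tree 2-clique, since trees are finite. A 2-cycle, which traverses one edge twice, is never counted as colorful. *)

(* Defs.v *)
From HB Require Import structures.
From mathcomp Require Import all_boot all_order finmap.
Set Implicit Arguments.
Unset Strict Implicit.
Unset Printing Implicit Defensive.
Import Order.TTheory.
Local Open Scope order_scope.
Local Open Scope fset_scope.

(* [color] is a total function; only its values on edges are meaningful. *)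
Record ecgraph (V C : choiceType) := ECGraph {
  edge : rel V;
  color : V -> V -> C;
  edge_irr : irreflexive edge;
  edge_sym : symmetric edge;
  color_sym : forall u v, edge u v -> color u v = color v u }.

Section Cliques.
Variables (V C : choiceType) (G : ecgraph V C).
Implicit Types (a b c : {fset V}) (P : {fset {fset V}}).

(* A clique is given by its (finite, nonempty) vertex set. *)
Definition is_clique a :=
  a != fset0 /\ {in a &, forall u v, u != v -> edge G u v}.

Definition subclique b a := b != fset0 /\ b `<=` a.

Definition colors b c : {fset C} :=
  [fset color G p.1 p.2 | p in b `*` c & edge G p.1 p.2].

Definition is_cycle (s : seq V) := (1 < size s)%N /\ ucycle (edge G) s.

(* Pairwise distinctness is over the indices of the cycle, so that a 2-cycle,
   which traverses a single edge twice, is never colorful. *)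
Definition colorful (s : seq V) := uniq [seq color G x (next s x) | x <- s].

Definition no_colorful_cycle a :=
  forall s : seq V, {subset s <= a} -> is_cycle s -> ~~ colorful s.

Definition gallai a :=
  forall s : seq V, {subset s <= a} -> is_cycle s -> size s = 3%N ->
    ~~ colorful s.

Definition is_partition P a :=
  [/\ fcover P = a, trivIfset P & fset0 \notin P].

Definition partition_colors P : {fset C} :=
  \bigcup_(b <- P) \bigcup_(c <- P | b != c) colors b c.

Definition two_partition P := (#|` partition_colors P| <= 2)%N.

Definition homogeneous P :=
  {in P &, forall b c, b != c ->
    {in b & c, forall u v, {in b & c, forall u' v',
      color G u v = color G u' v'}}}.

Definition nontrivial P :=
  (1 < #|` P|)%N /\ exists2 b, b \in P & #|` b| != 1%N.

Inductive hereditary_two_clique : {fset V} -> Prop :=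
| Hereditary1 v : hereditary_two_clique [fset v]
| HereditaryPartition a P :
    is_clique a -> is_partition P a -> two_partition P -> homogeneous P ->
    (forall b, b \in P -> hereditary_two_clique b) ->
    hereditary_two_clique a.

Definition irreducible a :=
  forall P, is_partition P a -> nontrivial P -> ~ homogeneous P.

End Cliques.

Section Trees.
Variables (d : Order.disp_t) (T : finPOrderType d).
Implicit Types s t u v : T.

Definition is_tree := forall s t, s >< t ->
  (exists u, s <= u /\ t <= u) /\ ~ (exists u, u <= s /\ u <= t).

Definition child s t := (s < t) && ~~ [exists u : T, (s < u) && (u < t)].

Definition children t : {fset T} := [fset s : T | child s t].

Definition leaf t := children t == fset0.

Definition sibling u v := (u >< v) && [exists p : T, child u p && child v p].

Variables (C : choiceType) (S : ecgraph T C).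

Definition sibling_coloring := edge S =2 sibling.

Definition two_coloring :=
  forall t, ~~ leaf t -> (#|` colors S (children t) (children t)| <= 2)%N.

(* For distinct leaves [s], [t] of a tree the pair [(u, v)] exists and is
   unique (see [sibling_above_exists], [leaf_colorE]); the default value is
   never used then. *)
Definition leaf_color s t : C :=
  if [pick p : T * T | [&& sibling p.1 p.2, s <= p.1 & t <= p.2]] is Some p
  then color S p.1 p.2 else color S s t.

Definition leaf_graph_iso (V : choiceType) (G : ecgraph V C) (a : {fset V})
    (f : V -> T) :=
  [/\ {in a &, injective f},
      f @` a = [fset t : T | leaf t] &
      {in a &, forall x y, x != y -> color G x y = leaf_color (f x) (f y)}].

Lemma child_above s m : s < m -> exists2 u, s <= u & child u m.
Proof.
move=> lt_sm; have Ps : (s <= s) && (s < m) by rewrite lexx.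
case: (@arg_maxnP _ s (fun u => (s <= u) && (u < m))
  (fun u => #|[set x : T | x <= u]|) Ps) => u /andP[lesu ltum] maxu.
exists u => //; rewrite /child ltum /=; apply/existsPn => v.
apply/negP => /andP[ltuv ltvm].
have Pv : (s <= v) && (v < m) by rewrite ltvm (le_trans lesu (ltW ltuv)).
have /= := maxu v Pv; rewrite leqNgt => /negP; apply; apply/proper_card/properP.
split; last by exists v; rewrite !inE // lt_geF.
by apply/subsetP => x; rewrite !inE => /le_trans; apply; apply: ltW.
Qed.

Lemma leafP t : reflect (forall s, s <= t -> s = t) (leaf t).
Proof.
apply: (iffP eqP) => [t0 s le_st | min_t].
  apply/eqP/negPn/negP => ne_st.
  have lt_st : s < t by rewrite lt_neqAle ne_st.
  have [u _ ut] := child_above lt_st.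
  by have : u \in children t; [rewrite !inE | rewrite t0 inE].
apply/fsetP => s; rewrite !inE /=; apply/negbTE/negP => /andP[lt_st _].
by have e := min_t s (ltW lt_st); rewrite e ltxx in lt_st.
Qed.

Lemma sibling_above_exists s t : is_tree -> leaf s -> leaf t -> s != t ->
  exists u v, [/\ sibling u v, s <= u & t <= v].
Proof.
move=> treeT /leafP min_s /leafP min_t ne_st.
have inc_st : s >< t.
  apply/negP => /orP[/min_t|/min_s] e; first by rewrite e eqxx in ne_st.
  by rewrite e eqxx in ne_st.
have [[m0 [sm0 tm0]] no_lb] := treeT s t inc_st.
have Pm0 : (s <= m0) && (t <= m0) by rewrite sm0.
case: (@arg_minnP _ m0 (fun u => (s <= u) && (t <= u))
  (fun u => #|[set x : T | x <= u]|) Pm0) => m /andP[lesm letm] minm.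
have ltsm : s < m.
  by rewrite lt_neqAle lesm andbT; apply/eqP => e; case: no_lb; exists t; rewrite e.
have lttm : t < m.
  by rewrite lt_neqAle letm andbT; apply/eqP => e; case: no_lb; exists s; rewrite e.
have no_ub u : u < m -> s <= u -> t <= u -> False.
  move=> ltum su tu; have Pu : (s <= u) && (t <= u) by rewrite su.
  have /= := minm u Pu; rewrite leqNgt => /negP; apply; apply/proper_card/properP.
  split; last by exists m; rewrite !inE // lt_geF.
  by apply/subsetP => x; rewrite !inE => /le_trans; apply; apply: ltW.
have [u su um] := child_above ltsm; have [v tv vm] := child_above lttm.
exists u, v; split => //; apply/andP; split; last by apply/existsP; exists m; rewrite um.
have [ltum _] := andP um; have [ltvm _] := andP vm.
apply/negP => /orP[leuv|levu].
  exact: (no_ub v ltvm (le_trans su leuv) tv).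
exact: (no_ub u ltum su (le_trans tv levu)).
Qed.

Lemma sibling_above_unique s t u v u' v' : is_tree ->
  sibling u v -> s <= u -> t <= v -> sibling u' v' -> s <= u' -> t <= v' ->
  (u', v') = (u, v).
Proof.
move=> treeT.
have up (w x y : T) : w <= x -> w <= y -> x >=< y.
  by move=> wx wy; apply/negPn/negP => inc; have [_ no_lb] := treeT x y inc; apply: no_lb; exists w.
have aux (s1 t1 u1 v1 u2 v2 : T) : sibling u1 v1 -> s1 <= u1 -> t1 <= v1 ->
    sibling u2 v2 -> s1 <= u2 -> t1 <= v2 -> ~~ (u1 < u2).
  case/andP=> _ /existsP[p /andP[/andP[u1p nu1p] /andP[v1p _]]] su1 tv1.
  case/andP=> inc2 _ su2 tv2; apply/negP => lt12.
  have := up _ _ _ (le_trans su1 (ltW u1p)) su2.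
  case/orP=> [pu2|u2p]; last first.
    have [e|ne] := eqVneq u2 p.
      by case/negP: inc2; apply: (up t1) => //; rewrite e (le_trans tv1) // ltW.
    case/negP: nu1p; apply/existsP; exists u2; rewrite lt12 /=.
    by rewrite lt_neqAle ne.
  case/negP: inc2; apply: (up t1) => //.
  exact: le_trans tv1 (le_trans (ltW v1p) pu2).
have sibC (x y : T) : sibling x y -> sibling y x.
  case/andP=> i /existsP[p]; rewrite andbC => c.
  by rewrite /sibling comparable_sym i; apply/existsP; exists p.
move=> sib su tv sib' su' tv'.
have eqc (w x y : T) : w <= x -> w <= y -> ~~ (x < y) -> ~~ (y < x) -> x = y.
  by move=> wx wy; have := up w x y wx wy; case: comparableP.
have sibT := sibC _ _ sib; have sibT' := sibC _ _ sib'.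
congr (_, _).
  by apply: (eqc s) => //; [apply: (aux s t u' v' u v) | apply: (aux s t u v u' v')].
by apply: (eqc t) => //; [apply: (aux t s v' u' v u) | apply: (aux t s v u v' u')].
Qed.

Lemma leaf_colorE s t u v : is_tree -> sibling u v -> s <= u -> t <= v ->
  leaf_color s t = color S u v.
Proof.
move=> treeT sib su tv; rewrite /leaf_color.
case: pickP => [[u' v'] /= /and3P[sib' su' tv'] | /(_ (u, v))]; last by rewrite /= sib su tv.
by have [-> ->] := sibling_above_unique treeT sib su tv sib' su' tv'.
Qed.

End Trees.

Definition tree_two_clique (V C : choiceType) (G : ecgraph V C)
    (a : {fset V}) : Prop :=
  exists (d : Order.disp_t) (T : finPOrderType d) (S : ecgraph T C) (f : V -> T),
    [/\ is_tree T, sibling_coloring S, two_coloring S & leaf_graph_iso S G a f].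

(* The factor at [t] is the clique [children t] of the sibling graph [S]. *)
Definition hereditarily_irreducible_two_clique (V C : choiceType)
    (G : ecgraph V C) (a : {fset V}) : Prop :=
  exists (d : Order.disp_t) (T : finPOrderType d) (S : ecgraph T C) (f : V -> T),
    [/\ is_tree T, sibling_coloring S, two_coloring S & leaf_graph_iso S G a f] /\
    (forall t : T, ~~ leaf t -> irreducible S (children t)).

(* Main.v *)
Require Import Defs.
From HB Require Import structures.
From mathcomp Require Import all_boot all_order finmap.
From mathcomp Require Import zify.
From Stdlib Require Import Classical.
Set Implicit Arguments.
Unset Strict Implicit.
Unset Printing Implicit Defensive.
Local Open Scope fset_scope.

(* Everything is compared with the absence of rainbow triangles.

   The core is Gallai's partition theorem.  In a clique without rainbow
   triangles, the components of a color are joined to each other by homogeneous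
   edges of other colors, and if at least three colors occur then some occurring
   color is disconnected.  Now take a homogeneous partition with at least two
   blocks and as few blocks as possible.  Were three colors to occur between the
   blocks, the components of a disconnected color on a transversal would merge
   the blocks into a coarser homogeneous partition.  So this is a 2-partition,
   and by the same merging argument its quotient is irreducible.

   Iterating it inside each block gives a laminar family of vertex sets, which
   under inclusion is a tree with irreducible factors.  Conversely, among three
   leaves of a tree either two of them separate from the third at the same pair
   of siblings, or all three separate at one node, whose factor has at most two
   colors. *)

(** * Minimal elements and choice over finite lists *)

Lemma ex_minimal (T : Type) (A : T -> Prop) (m : T -> nat) :
  (exists x, A x) -> exists x, A x /\ forall y, A y -> (m x <= m y)%N.
Proof.
case=> x; have [n] := ubnP (m x); elim: n x => // n IHn x lemx Ax.
have [[y [Ay lty]]|nmin] := classic (exists y, A y /\ (m y < m x)%N).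
  by apply: IHn Ay; lia.
exists x; split=> // y Ay; rewrite leqNgt; apply/negP => lty.
by apply: nmin; exists y.
Qed.

(** Over a finite list, induction replaces an axiom of choice; [B0] is the value of [g] off the
    list. *)
Lemma finite_choice (A : eqType) (B : Type) (R : A -> B -> Prop) (B0 : B)
    (s : seq A) :
  (forall x, x \in s -> exists y, R x y) ->
  exists g : A -> B, forall x, x \in s -> R x (g x).
Proof.
elim: s => [|x s IHs] exR; first by exists (fun=> B0).
have [g gP] := IHs (fun y ys => exR y (mem_behead (s := x :: s) ys)).
have [y xy] := exR x (mem_head _ _).
exists (fun z => if z == x then y else g z) => z; rewrite inE.
by case: eqP => [-> //|_ /= /gP].
Qed.

(** * Partitions of finite vertex sets *)

Section Partitions.
Variable V : choiceType.
Implicit Types (a b c : {fset V}) (P Q : {fset {fset V}}).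

Lemma fpartition_cover P a x : is_partition P a -> x \in a ->
  exists2 b, b \in P & x \in b.
Proof. by case=> <- _ _ /bigfcupP[b /andP[bP _] xb]; exists b. Qed.

Lemma fpartition_sub P a b : is_partition P a -> b \in P -> b `<=` a.
Proof. by case=> <- _ _ bP; exact: bigfcup_sup. Qed.

Lemma fpartition_block_eq P a b c x : is_partition P a ->
  b \in P -> c \in P -> x \in b -> x \in c -> b = c.
Proof.
case=> _ /trivIfsetP tP _ bP cP xb xc; apply/eqP/negPn/negP => /(tP b c bP cP).
by move=> /fdisjointP/(_ x xb); rewrite xc.
Qed.

Lemma fpartition_neq0 P a b : is_partition P a -> b \in P -> exists x, x \in b.
Proof. by case=> _ _ P0 bP; apply/fset0Pn; apply: contraNneq P0 => <-. Qed.

Lemma is_partitionI P a :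
  (forall b, b \in P -> b `<=` a /\ exists x, x \in b) ->
  (forall x, x \in a -> exists2 b, b \in P & x \in b) ->
  (forall b c x, b \in P -> c \in P -> x \in b -> x \in c -> b = c) ->
  is_partition P a.
Proof.
move=> sub cov dis; split.
- apply/fsetP => x; apply/bigfcupP/idP => [[b /andP[/sub[/fsubsetP bs _] _]]|].
    exact: bs.
  by move=> /cov[b bP xb]; exists b; rewrite ?bP.
- apply/trivIfsetP => b c bP cP; apply: contraNT => /fdisjointP nd.
  apply/eqP; have [x xb xc] : exists2 x, x \in b & x \in c.
    apply: NNPP => nex; apply: nd => x xb; apply/negP => xc.
    by apply: nex; exists x.
  exact: dis xb xc.
- by apply/negP => /sub[_ [x]].
Qed.

Lemma exists_other_block P b : (1 < #|` P|)%N -> b \in P ->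
  exists2 c, c \in P & b != c.
Proof.
move=> P1 bP; have [|[c]] := fset_0Vmem (P `\ b).
  by move=> /eqP; rewrite -cardfs_eq0; move: P1; rewrite (cardfsD1 b) bP; lia.
by rewrite !inE => /andP[cb cP]; exists c; rewrite // eq_sym.
Qed.

Lemma two_blocks_card P b c : b \in P -> c \in P -> b != c -> (1 < #|` P|)%N.
Proof.
by move=> bP cP bc; rewrite (cardfsD1 b) bP (cardfsD1 c) !inE eq_sym bc cP.
Qed.

Lemma fpartition_block_proper P a b : is_partition P a -> (1 < #|` P|)%N ->
  b \in P -> b `<` a.
Proof.
move=> pP P1 bP; have [c cP bc] := exists_other_block P1 bP.
have [x xc] := fpartition_neq0 pP cP.
rewrite fproperE (fpartition_sub pP bP) /=; apply/fsubsetPn; exists x.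
  exact: (fsubsetP (fpartition_sub pP cP)).
by apply: contraNN bc => xb; apply/eqP/(fpartition_block_eq pP bP cP xb).
Qed.

Definition singletons a : {fset {fset V}} := [fset [fset x] | x in a].

Lemma singletonsP a b :
  reflect (exists2 x, x \in a & b = [fset x]) (b \in singletons a).
Proof. exact: imfsetP. Qed.

Lemma singletons_partition a : is_partition (singletons a) a.
Proof.
apply: is_partitionI.
- move=> b /singletonsP[x xa ->]; rewrite fsub1set xa; split => //.
  by exists x; rewrite inE.
- by move=> x xa; exists [fset x]; rewrite ?inE //; apply/singletonsP; exists x.
move=> b c z /singletonsP[x _ ->] /singletonsP[y _ ->].
by rewrite !inE => /eqP-> /eqP->.
Qed.

Lemma card_singletons a : #|` singletons a| = #|` a|.
Proof. by rewrite card_imfset //; apply: fset1_inj. Qed.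

End Partitions.

(** * Rainbow triangles, colorful cycles and color counts *)

Section Gallai.
Variables (V C : choiceType) (G : ecgraph V C).
Implicit Types (a b c : {fset V}) (P Q : {fset {fset V}}).

Lemma colorsP b c k :
  reflect (exists x y, [/\ x \in b, y \in c, edge G x y & k = color G x y])
          (k \in colors G b c).
Proof.
apply: (iffP idP) => [/imfsetP[[x y] /=]|[x [y [xb yc xy ->]]]].
  by rewrite !inE /= => /andP[/andP[? ?] ?] ->; exists x, y.
by apply/imfsetP; exists (x, y); rewrite // !inE /= xb yc.
Qed.

Lemma sub_clique a b : is_clique G a -> b `<=` a -> b != fset0 -> is_clique G b.
Proof. by move=> [_ ha] /fsubsetP ba b0; split => // x y /ba xa /ba; apply: ha. Qed.

Lemma mem_colors a b c x y : is_clique G a -> b `<=` a -> c `<=` a ->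
  x \in b -> y \in c -> x != y -> color G x y \in colors G b c.
Proof.
move=> [_ ha] /fsubsetP ba /fsubsetP ca xb yc xy; apply/colorsP; exists x, y.
by split=> //; apply: ha => //; [apply: ba|apply: ca].
Qed.

Lemma clique_colorC a x y : is_clique G a -> x \in a -> y \in a ->
  color G x y = color G y x.
Proof.
move=> [_ ha] xa ya; have [-> //|xy] := eqVneq x y.
by apply: color_sym; apply: ha.
Qed.

Lemma partition_colorsP P k :
  reflect (exists b c x y, [/\ b \in P, c \in P, b != c &
             [/\ x \in b, y \in c, edge G x y & k = color G x y]])
          (k \in partition_colors G P).
Proof.
apply: (iffP idP) => [/bigfcupP[b /andP[bP _] /bigfcupP[c /andP[cP bc]]]|].
  by move=> /colorsP[x [y xyP]]; exists b, c, x, y.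
move=> [b [c [x [y [bP cP bc xyP]]]]]; apply/bigfcupP; exists b; rewrite ?bP //.
by apply/bigfcupP; exists c; rewrite ?cP //; apply/colorsP; exists x, y.
Qed.

(** The Gallai condition on three vertices, without cycles as sequences; on a clique it amounts to
    [gallai], by [gallaiP]. *)
Definition rainbow_free a := {in a & &, forall x y z,
  x != y -> y != z -> x != z ->
  ~~ uniq [:: color G x y; color G y z; color G x z]}.

Lemma sub_rainbow_free a b : b `<=` a -> rainbow_free a -> rainbow_free b.
Proof. by move=> /fsubsetP ba ra x y z /ba xa /ba ya /ba; apply: ra. Qed.

Lemma rainbow_freeE a x y z : is_clique G a -> rainbow_free a ->
  x \in a -> y \in a -> z \in a -> x != y -> y != z -> x != z ->
  color G x z != color G x y -> color G x z != color G y z ->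
  color G x y = color G y z.
Proof.
move=> ha ra xa ya za xy yz xz n1 n2; apply/eqP.
have := ra x y z xa ya za xy yz xz; rewrite /= !inE ![_ == color G x z]eq_sym.
by rewrite (negbTE n1) (negbTE n2) /= orbF andbT negbK.
Qed.

(** Unrolling [next] into the closed walk from [x] back to [x] allows induction on [s]. *)
Lemma colorfulE x s : uniq (x :: s) ->
  colorful G (x :: s) = uniq (pairmap (color G) x (rcons s x)).
Proof.
move=> us; rewrite /colorful; congr uniq.
apply: (@eq_from_nth _ (color G x x)) => [|i].
  by rewrite size_map size_pairmap size_rcons.
rewrite size_map => ltis.
rewrite (nth_map x) // (nth_pairmap x) ?size_rcons //.
rewrite next_nth mem_nth // index_uniq //; congr color.
  by rewrite -rcons_cons nth_rcons ltis.
have [e|ne] := eqVneq i (size s).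
  by rewrite e nth_default // nth_rcons ltnn eqxx.
by rewrite nth_rcons ltn_neqAle ne -ltnS ltis.
Qed.

Lemma clique_cycle a s : is_clique G a -> {subset s <= a} -> uniq s ->
  (1 < size s)%N -> is_cycle G s.
Proof.
case=> _ ha sa us s1; split=> //; rewrite /ucycle us andbT.
case: s sa us s1 => [//|x s] sa us s1 /=; apply/(pathP x) => i.
rewrite size_rcons ltnS => leis; apply: ha.
- by apply: sa; rewrite -rcons_cons nth_rcons /= ltnS leis mem_nth //=.
- rewrite nth_rcons; case: ltngtP leis => // [lt _|_ _]; apply: sa.
    by rewrite inE mem_nth ?orbT.
  exact: mem_head.
rewrite -rcons_cons !nth_rcons /= ltnS leis.
case: ltngtP leis => // [lt _|e _].
  have := nth_uniq x (s := x :: s) (i := i) (j := i.+1).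
  by rewrite /= !ltnS leq_eqVlt lt orbT => /(_ isT isT us)->; rewrite neq_ltn ltnSn.
(* The closing edge joins the last vertex to the first; they differ because the sequence has at
   least two vertices. *)
have /= := nth_uniq x (s := x :: s) (i := i) (j := 0).
by rewrite ltnS e leqnn => /(_ isT isT us)->; move: s1; rewrite /=; lia.
Qed.

Lemma gallaiP a : is_clique G a -> gallai G a <-> rainbow_free a.
Proof.
move=> ha; split=> [ga x y z xa ya za xy yz xz | ra].
  have us : uniq [:: x; y; z] by rewrite /= !inE negb_or xy xz yz.
  have sa : {subset [:: x; y; z] <= a}.
    by move=> w; rewrite !inE => /or3P[] /eqP->.
  have := ga _ sa (clique_cycle ha sa us isT) erefl.
  by rewrite colorfulE //= (clique_colorC ha za xa).
case=> [//|x [//|y [//|z [|//]]]] sa [_ /andP[_ us]] _; rewrite colorfulE //.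
have [xa ya za] : [/\ x \in a, y \in a & z \in a].
  by split; apply: sa; rewrite !inE eqxx ?orbT.
have /and3P[+ + _] := us; rewrite !inE negb_or => /andP[xy xz] yz.
by rewrite /= (clique_colorC ha za xa); apply: ra.
Qed.

(* A chord of a colorful cycle either closes a colorful triangle or shortens
   the cycle. *)
Lemma rainbow_free_cycle a x s : is_clique G a -> rainbow_free a ->
  {subset x :: s <= a} -> uniq (x :: s) -> s != [::] ->
  ~~ uniq (pairmap (color G) x (rcons s x)).
Proof.
move=> ha ra; have [n] := ubnP (size s); elim: n s => // n IHn [|y [|z s]] // lesn sa us _.
  (* A 2-cycle runs along one edge twice, so its two colors agree. *)
  by rewrite /= (clique_colorC ha (x := y)) ?mem_seq1 ?eqxx //; apply: sa; rewrite !inE eqxx ?orbT.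
have [xa ya za] : [/\ x \in a, y \in a & z \in a].
  by split; apply: sa; rewrite !inE eqxx ?orbT.
have /and3P[+ + us'] := us; rewrite !inE !negb_or => /and3P[xy xz xs] /andP[yz _].
have [e|nxy] := eqVneq (color G x y) (color G y z); first by rewrite /= e !inE eqxx.
have /= IH : ~~ uniq (pairmap (color G) x (rcons (z :: s) x)).
  apply: IHn => //; last by rewrite cons_uniq !inE negb_or xz xs.
  by move=> w; rewrite !inE => ws; apply: sa; rewrite !inE; case/orP: ws => ->; rewrite ?orbT.
(* The chord [xz] repeats the color of [xy] or of [yz], so putting it in place of these two edges
   would keep distinct colors distinct. *)
have e : (color G x z == color G x y) || (color G x z == color G y z).
  have := ra x y z xa ya za xy yz xz; apply: contraNT; rewrite negb_or => /andP[n1 n2].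
  by rewrite /= !inE negb_or nxy ![_ == color G x z]eq_sym n1 n2.
apply: contraNN IH; rewrite /= !inE !negb_or => /and3P[/andP[_ n1] n2 ->].
by rewrite andbT; case/orP: e => /eqP->; rewrite ?n1 ?n2.
Qed.

Lemma rainbow_free_no_colorful_cycle a :
  is_clique G a -> rainbow_free a -> no_colorful_cycle G a.
Proof.
move=> ha ra [|x s] sa [s1 /andP[_ us]] //; rewrite colorfulE //.
by apply: (rainbow_free_cycle ha ra) => //; case: (s) s1.
Qed.

Lemma card_no_rainbow (K : {fset C}) k1 k2 k3 : (#|` K| <= 2)%N ->
  k1 \in K -> k2 \in K -> k3 \in K -> ~~ uniq [:: k1; k2; k3].
Proof.
move=> K2 k1K k2K k3K; apply/negP => u.
have : [fset k in [:: k1; k2; k3]] `<=` K.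
  by apply/fsubsetP => k; rewrite !inE ?orbF => /or3P[] /eqP->.
by move=> /fsubset_leq_card; rewrite card_fseq undup_id //= leqNgt ltnS K2.
Qed.

(** A triangle inside one block is handled by induction. If exactly two vertices share a block,
    homogeneity gives their edges to the third the same color; if no two do, all three edges run
    between blocks, where at most two colors occur. *)
Lemma hereditary_rainbow_free a : hereditary_two_clique G a -> rainbow_free a.
Proof.
elim=> {a} [v x y z /fset1P-> /fset1P->|a P ha pP twoP homP _ IH x y z xa ya za].
  by rewrite eqxx.
have [bx bxP xbx] := fpartition_cover pP xa.
have [by_ byP yby] := fpartition_cover pP ya.
have [bz bzP zbz] := fpartition_cover pP za => xy yz xz.
have symC := clique_colorC ha.
have [exy|nxy] := eqVneq bx by_.
  have [exz|nxz] := eqVneq bx bz.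
    by apply: IH bxP _ _ _ _ _ _ _ _ _ => //; rewrite ?exy // -exy exz.
  suff -> : color G x z = color G y z by rewrite /= !inE eqxx andbF.
  by rewrite -exy in yby; apply: (homP bx bz).
have [exz|nxz] := eqVneq bx bz.
  suff -> : color G x y = color G y z by rewrite /= !inE eqxx.
  by rewrite -exz in zbz; rewrite (symC y z) //; apply: (homP bx by_).
have [eyz|nyz] := eqVneq by_ bz.
  suff -> : color G x y = color G x z by rewrite /= !inE eqxx orbT.
  by rewrite -eyz in zbz; apply: (homP bx by_).
apply: (card_no_rainbow twoP); apply/partition_colorsP;
  [exists bx, by_, x, y | exists by_, bz, y, z | exists bx, bz, x, z];
  by split=> //; split=> //; apply: ha.2.
Qed.

(** Each vertex [v] of [c] brings at most one new color: if [xv] and [yv] both have colors not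
    occurring in [b], then both differ from the color of [xy], and the triangle forces them to
    agree. *)
Lemma rainbow_free_outer_colors a b c : is_clique G a -> rainbow_free a ->
  b `<=` a -> c `<=` a -> [disjoint b & c] ->
  (#|` colors G b c `\` colors G b b| <= #|` c|)%N.
Proof.
move=> ha ra ba ca dbc.
have [->|[u0 u0b]] := fset_0Vmem b.
  suff -> : colors G fset0 c = fset0 by rewrite fset0D cardfs0.
  by apply/fsetP => k; rewrite [RHS]inE; apply/colorsP => -[x [y []]]; rewrite inE.
pose new v k := k \in colors G b [fset v] `\` colors G b b.
have new1 v : v \in c -> forall k k', new v k -> new v k' -> k = k'.
  move=> vc k k'; rewrite /new !in_fsetD => /andP[nk /colorsP[x [_ [xb /fset1P-> _ ek]]]].
  move=> /andP[nk' /colorsP[y [_ [yb /fset1P-> _ ek']]]].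
  have [e|xy] := eqVneq x y; first by rewrite ek ek' e.
  have ne z : z \in b -> z != v.
    by move=> zb; apply: contraTneq vc => <-; apply: (fdisjointP dbc).
  have xyb := mem_colors ha ba ba xb yb xy.
  have sub := fsubsetP ba; have va := fsubsetP ca v vc.
  rewrite ek ek' (clique_colorC ha (sub y yb) va).
  have vy : v != y by rewrite eq_sym ne.
  apply: (rainbow_freeE ha ra (sub x xb) va (sub y yb) (ne x xb) vy xy).
    by apply: contraNneq nk; rewrite ek => <-.
  apply: contraNneq nk'; rewrite ek' => e.
  by rewrite (clique_colorC ha (sub y yb) va) -e.
(* [f v] is the new color brought by [v]; when there is none, the color of [u0 v] serves as a dummy
   value. *)
pose f v := oapp (fun x : b => color G v (val x)) (color G u0 v) [pick x : b | new v (color G v (val x))].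
have sub : colors G b c `\` colors G b b `<=` f @` c.
  apply/fsubsetP => k; rewrite inE => /andP[nk /colorsP[x [v [xb vc xv ek]]]].
  have xa := fsubsetP ba x xb; have va := fsubsetP ca v vc.
  have nv : new v k.
    rewrite /new inE nk /=; apply/colorsP; exists x, v; split=> //; exact: fset11.
  apply/imfsetP; exists v => //=; rewrite /f.
  case: pickP => [y /= ny|/(_ [` xb]) /=]; first exact: new1 nv ny.
  by rewrite (clique_colorC ha va xa) -ek nv.
by apply: leq_trans (fsubset_leq_card sub) _; apply: leq_imfset_card.
Qed.

(** Induction on the size of [b]: after deletion of a vertex [v], the hypothesis for [b] without [v]
    and [[fset v]] says that restoring [v] adds at most one color. *)
Lemma card_colors_of_outer a :
  is_clique G a ->
  (forall b c : {fset V}, subclique b a -> subclique c a -> [disjoint b & c] ->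
     (#|` colors G b c `\` colors G b b| <= #|` c|)%N) ->
  forall b : {fset V}, subclique b a -> (#|` colors G b b| <= #|` b| - 1)%N.
Proof.
move=> ha H b; have [n] := ubnP #|` b|; elim: n b => // n IHn b ltbn [/fset0Pn[v vb] ba].
have := cardfsD1 v b; rewrite vb => cb.
have [e0|ne0] := eqVneq (b `\ v) fset0.
  suff -> : colors G b b = fset0 by rewrite cardfs0.
  have bv w : w \in b -> w = v.
    move=> wb; apply/eqP/negPn/negP => wv.
    by have := in_fset0 w; rewrite -e0 !inE wv wb.
  apply/fsetP => k; rewrite [RHS]inE; apply/colorsP => -[x [y [/bv-> /bv->]]].
  by rewrite edge_irr.
have b'a : b `\ v `<=` a by apply: fsubset_trans ba; apply: fsubD1set.
have va : [fset v] `<=` a by rewrite fsub1set (fsubsetP ba).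
have sb' : subclique (b `\ v) a by [].
have sv : subclique [fset v] a by split=> //; apply/fset0Pn; exists v; rewrite inE.
have dis : [disjoint b `\ v & [fset v]] by rewrite fdisjointX1 !inE eqxx.
have lt' : (#|` b `\ v| < n)%N by lia.
have := IHn _ lt' sb'; have := H _ _ sb' sv dis; rewrite cardfs1.
set A := colors G (b `\ v) [fset v]; set B := colors G (b `\ v) (b `\ v) => cA cB.
have sub : colors G b b `<=` B `|` (A `\` B).
  rewrite fsetUDl fsetDv fsetD0; apply/fsubsetP => k.
  move=> /colorsP[x [y [xb yb xy ->]]]; have nxy : x != y.
    by apply: contraTneq xy => ->; rewrite edge_irr.
  have xa := fsubsetP ba x xb; have ya := fsubsetP ba y yb.
  rewrite inE; have [ex|nx] := eqVneq x v.
    rewrite (clique_colorC ha xa ya); apply/orP; right; apply: (mem_colors ha) => //.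
    - by rewrite !inE yb -ex eq_sym nxy.
    - by rewrite ex inE.
    - by rewrite eq_sym.
  have [ey|ny] := eqVneq y v.
    apply/orP; right; apply: (mem_colors ha) => //; first by rewrite !inE nx.
    by rewrite ey inE.
  by apply/orP; left; apply: (mem_colors ha); rewrite // !inE ?nx ?ny.
have := fsubset_leq_card sub; rewrite cardfsU.
by move: ne0; rewrite -cardfs_eq0; lia.
Qed.

(** A rainbow triangle would be a subclique with three vertices and three colors. *)
Lemma rainbow_free_of_card_colors a : is_clique G a ->
  (forall b : {fset V}, subclique b a -> (#|` colors G b b| <= #|` b| - 1)%N) ->
  rainbow_free a.
Proof.
move=> ha H x y z xa ya za xy yz xz.
have ba : [fset w in [:: x; y; z]] `<=` a.
  by apply/fsubsetP => w; rewrite !inE ?orbF => /or3P[] /eqP->.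
have b0 : [fset w in [:: x; y; z]] != fset0.
  by apply/fset0Pn; exists x; rewrite !inE eqxx.
have := H _ (conj b0 ba); rewrite card_fseq undup_id ?subn1 /=; last first.
  by rewrite !inE negb_or xy xz yz.
by move=> /card_no_rainbow; apply; apply: (mem_colors ha) => //; rewrite !inE eqxx ?orbT.
Qed.

End Gallai.

(** * Color components and Gallai's partition theorem *)

Lemma card_partition_lt (I : choiceType) (Q : {fset {fset I}}) (K q : {fset I}) :
  is_partition Q K -> q \in Q -> (1 < #|` q|)%N -> (#|` Q| < #|` K|)%N.
Proof.
move=> pQ qQ q1; case: (pQ) => <- /eqP <- Q0.
rewrite card_fset_sum1 (big_fsetD1 q) //= [ltnRHS](big_fsetD1 q) //=.
rewrite -addSn leq_add // !big_seq; apply: leq_sum => b; rewrite !inE => /andP[_ bQ].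
by rewrite cardfs_gt0; apply: contraNneq Q0 => <-.
Qed.

Section Partition.
Variables (V C : choiceType) (G : ecgraph V C).
Implicit Types (a b c : {fset V}) (P Q : {fset {fset V}}).

(** Pulls a homogeneous partition of a quotient back to [a]. The sets [blk i] are the blocks, [H] on
    [K] is the quotient coloring, and the blocks are united along [Q]. The quotient is a transversal
    in [gallai_partition] and the set of children of a node in [node_graph_irreducible]. *)
Lemma homogeneous_merge (I : choiceType) (H : ecgraph I C) (K : {fset I})
    (blk : I -> {fset V}) a (Q : {fset {fset I}}) :
  (forall i, i \in K -> blk i `<=` a /\ exists x, x \in blk i) ->
  (forall x, x \in a -> exists2 i, i \in K & x \in blk i) ->
  (forall i j x, i \in K -> j \in K -> x \in blk i -> x \in blk j -> i = j) ->
  (forall i j x y, i \in K -> j \in K -> i != j -> x \in blk i -> y \in blk j ->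
     color G x y = color H i j) ->
  is_partition Q K -> homogeneous H Q ->
  exists Q', [/\ is_partition Q' a, homogeneous G Q' & #|` Q'| = #|` Q|].
Proof.
move=> sub cov dis colH pQ homQ.
pose U (q : {fset I}) := \bigcup_(i <- q) blk i.
have UP q x : reflect (exists2 i, i \in q & x \in blk i) (x \in U q).
  apply: (iffP idP) => [/bigfcupP[i /andP[iq _] xi]|[i iq xi]]; first by exists i.
  by apply/bigfcupP; exists i; rewrite ?iq.
have inK q i : q \in Q -> i \in q -> i \in K.
  by move=> /(fpartition_sub pQ)/fsubsetP; apply.
have Uinj q q' x : q \in Q -> q' \in Q -> x \in U q -> x \in U q' -> q = q'.
  move=> qQ q'Q /UP[i iq xi] /UP[j jq' xj].
  have e := dis i j x (inK _ _ qQ iq) (inK _ _ q'Q jq') xi xj.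
  by apply: (fpartition_block_eq pQ qQ q'Q iq); rewrite e.
have Une q : q \in Q -> exists x, x \in U q.
  move=> qQ; have [i iq] := fpartition_neq0 pQ qQ.
  have [_ [x xi]] := sub i (inK _ _ qQ iq); exists x; apply/UP; by exists i.
have QP b : b \in [fset U q | q in Q] -> exists2 q, q \in Q & b = U q.
  by move=> /imfsetP.
exists [fset U q | q in Q]; split.
- apply: is_partitionI.
  + move=> b /QP[q qQ ->]; split; last exact: Une.
    apply/fsubsetP => x /UP[i iq xi]; have [/fsubsetP s _] := sub i (inK _ _ qQ iq).
    exact: s.
  + move=> x /cov[i iK xi]; have [q qQ iq] := fpartition_cover pQ iK.
    by exists (U q); [apply/imfsetP; exists q | apply/UP; exists i].
  + by move=> b c x /QP[q qQ ->] /QP[q' q'Q ->] xb xc; rewrite (Uinj q q' x).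
- move=> b c /QP[q qQ ->] /QP[q' q'Q ->] nqq' x y /UP[i iq xi] /UP[j jq' yj].
  move=> x' y' /UP[i' i'q xi'] /UP[j' j'q' yj'].
  have nq : q != q' by apply: contraNneq nqq' => ->.
  have ne u v : u \in q -> v \in q' -> u != v.
    move=> uq vq'; apply: contraNneq nq => uv; apply/eqP.
    by apply: (fpartition_block_eq pQ qQ q'Q uq); rewrite uv.
  rewrite (colH i j x y (inK _ _ qQ iq) (inK _ _ q'Q jq') (ne i j iq jq') xi yj).
  rewrite (colH i' j' x' y' (inK _ _ qQ i'q) (inK _ _ q'Q j'q') (ne i' j' i'q j'q') xi' yj').
  exact: (homQ q q' qQ q'Q nq).
- rewrite card_in_imfset // => q q' qQ q'Q e.
  by have [x xq] := Une q qQ; apply: (Uinj q q' x) => //; rewrite -e.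
Qed.

Lemma singletons_homogeneous a : homogeneous G (singletons a).
Proof.
move=> b c /singletonsP[x _ ->] /singletonsP[y _ ->] _ x1 y1 /fset1P-> /fset1P->.
by move=> x2 y2 /fset1P-> /fset1P->.
Qed.

(* The blocks are the connected components of the color [k]. *)
Lemma cut_partition a k (X : {fset V}) : is_clique G a -> rainbow_free G a ->
  X != fset0 -> X `<` a ->
  (forall x y, x \in X -> y \in a -> y \notin X -> color G x y != k) ->
  exists P, [/\ is_partition P a, homogeneous G P, (1 < #|` P|)%N &
    forall b c x y, b \in P -> c \in P -> b != c -> x \in b -> y \in c ->
      color G x y != k].
Proof.
move=> ha ra /fset0Pn[x0 x0X] Xa cutX.
pose e : rel a := [rel u v | (val u != val v) && (color G (val u) (val v) == k)].
have symC := clique_colorC ha.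
have e_sym : symmetric e.
  by move=> u v; rewrite /e /= eq_sym (symC _ _ (valP u) (valP v)).
have cs : connect_sym e by apply: sym_connect_sym.
pose K u : {fset V} := [fset val v | v : a & connect e u v].
have KP u x : reflect (exists2 v, connect e u v & x = val v) (x \in K u).
  apply: (iffP idP) => [/imfsetP[v /= uv ->]|[v uv ->]]; first by exists v.
  by apply/imfsetP; exists v.
have Keq u v : connect e u v -> K u = K v.
  move=> uv; apply/fsetP => x; apply/KP/KP => -[w c ->]; exists w => //.
    by rewrite cs in uv; apply: connect_trans uv c.
  exact: connect_trans uv c.
pose P := [fset K u | u : a].
have PP b : b \in P -> exists u, b = K u by move=> /imfsetP[u _ ->]; exists u.
have KinP u : K u \in P by apply/imfsetP; exists u.
have nonk u v : ~~ connect e u v -> color G (val u) (val v) != k.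
  apply: contraNN => uk; have [->|uv] := eqVneq u v; first exact: connect0.
  by apply: connect1; rewrite /e /= uk andbT.
(* Walk along edges of color [k]. For such an edge [vz] and [u] in another component, neither [uv]
   nor [uz] has color [k], so the triangle forces their colors to agree. *)
have homK u v w : connect e v w -> ~~ connect e v u ->
    color G (val u) (val v) = color G (val u) (val w).
  move=> /connectP[p pth ->]; elim: p v pth => [//|z p IHp] v /= /andP[vz pth] nvu.
  have nzu : ~~ connect e z u.
    by apply: contraNN nvu; apply: connect_trans; apply: connect1.
  rewrite -IHp // (symC _ _ (valP u) (valP v)).
  have nuv := nonk _ _ nvu; have nuz := nonk _ _ nzu.
  case/andP: (vz) => /= nevz /eqP ck.
  have ne t : ~~ connect e t u -> val t != val u.
    by apply: contraNneq => /val_inj->; apply: connect0.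
  have uz : val u != val z by rewrite eq_sym ne.
  apply: (rainbow_freeE ha ra (valP v) (valP u) (valP z) (ne v nvu) uz nevz).
    by rewrite ck eq_sym.
  by rewrite ck eq_sym (symC _ _ (valP u) (valP z)).
exists P; split.
- apply: is_partitionI.
  + move=> b /PP[u ->]; split; last by exists (val u); apply/KP; exists u => //; apply: connect0.
    by apply/fsubsetP => x /KP[v _ ->]; apply: valP.
  + move=> x xa; exists (K [` xa]) => //; apply/KP; exists [` xa] => //; exact: connect0.
  + move=> b c x /PP[u ->] /PP[v ->] /KP[w uw ->] /KP[w' vw' /val_inj ew].
    by rewrite (Keq _ _ uw) (Keq _ _ vw') ew.
- move=> b c /PP[u ->] /PP[v ->] nuv x y /KP[p up ->] /KP[q vq ->].
  move=> x' y' /KP[p' up' ->] /KP[q' vq' ->].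
  have nc s t : connect e u s -> connect e v t -> ~~ connect e t s.
    move=> us vt; apply: contraNN nuv => ts; apply/eqP.
    by rewrite (Keq _ _ us) -(Keq _ _ ts) -(Keq _ _ vt).
  have cqq' : connect e q q' by rewrite cs in vq; apply: connect_trans vq vq'.
  have cpp' : connect e p p' by rewrite cs in up; apply: connect_trans up up'.
  rewrite (homK p q q') ?nc // (symC _ _ (valP p) (valP q')).
  rewrite (homK q' p p') //; last by rewrite cs nc.
  exact: symC (valP q') (valP p').
(* No edge of color [k] leaves [X], so a path of color [k] from [x0] stays in [X] and never reaches
   [y]. *)
- have [Xa' [y ya yX]] : X `<=` a /\ exists2 y, y \in a & y \notin X.
    by move: Xa; rewrite fproperE => /andP[? /fsubsetPn].
  have x0a := fsubsetP Xa' x0 x0X.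
  apply: (@two_blocks_card _ P (K [` x0a]) (K [` ya])) => //.
  apply/eqP => eK; have : val [` ya] \in K [` x0a].
    by rewrite eK; apply/KP; exists [` ya] => //; apply: connect0.
  move=> /KP[v /connectP[p + ->]] ev.
  have : val [` x0a] \in X by [].
  have : val (last [` x0a] p) \notin X by rewrite -ev.
  elim: p [` x0a] {eK ev} => [|z p IHp] u /=; first by move=> /negP.
  move=> lX uX /andP[/andP[_ /eqP uz] pz]; apply: IHp lX _ pz.
  by apply: contraTT isT => zX; have := cutX _ _ uX (valP z) zX; rewrite uz eqxx.
- move=> b c x y /PP[u ->] /PP[v ->] nuv /KP[p up ->] /KP[q vq ->].
  apply: nonk; apply: contraNN nuv => pq; apply/eqP.
  by rewrite (Keq _ _ up) (Keq _ _ pq) -(Keq _ _ vq).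
Qed.

(** The graph of some occurring color [k] is disconnected on [a]; [X] is a union of its
    components. *)
Definition has_cut a := exists k (X : {fset V}),
  [/\ k \in colors G a a, X != fset0, X `<` a &
      forall x y, x \in X -> y \in a -> y \notin X -> color G x y != k].

(** The vertex [v] is isolated in color [k], and an edge of color [k] supplies a vertex other than
    [v]. *)
Lemma star_cut a v k : is_clique G a -> v \in a -> k \in colors G a a ->
  (forall w, w \in a -> w != v -> color G v w != k) -> has_cut a.
Proof.
move=> ha va ka star; exists k, [fset v]; split=> //.
- by apply/fset0Pn; exists v; rewrite inE.
- rewrite fproperE fsub1set va /=; apply/fsubsetPn.
  have /colorsP[x [y [xa ya xy _]]] := ka.
  have [e|nx] := eqVneq x v; [exists y | exists x] => //; rewrite inE // -e.
  by apply: contraTneq xy => ->; rewrite edge_irr.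
- by move=> x y /fset1P-> ya; rewrite inE; apply: star.
Qed.

Lemma colors_notin a (K : {fset C}) : (#|` K| < #|` colors G a a|)%N ->
  exists2 k, k \in colors G a a & k \notin K.
Proof.
move=> lt; apply/fsubsetPn; apply: contraTN lt => /fsubset_leq_card.
by rewrite leqNgt.
Qed.

(* Induction on the number of vertices: delete a vertex [v]; the components of
   a disconnected color of [a `\ v] are all joined to [v] by that color, unless
   one of them stays a component of [a], and then [v] sees only one other
   color. *)
Lemma rainbow_free_cut a : is_clique G a -> rainbow_free G a ->
  (2 < #|` colors G a a|)%N -> has_cut a.
Proof.
have [n] := ubnP #|` a|; elim: n a => // n IHn a lta ha ra col3.
have symC := clique_colorC ha.
have [v va] : exists v, v \in a by apply/fset0Pn; case: ha.
have ca := cardfsD1 v a; rewrite va in ca.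
have a'a : a `\ v `<=` a by apply: fsubD1set.
have sub' := fsubsetP a'a.
(* Suppose that [k] occurs only at [v]. An edge [vw] of another color leaves [w] isolated in color
   [k]; if there is none, every edge at [v] has color [k], and [v] is isolated in any second
   color. *)
have [[k [ka knew]]|nonew] := classic (exists k, k \in colors G a a /\
    k \notin colors G (a `\ v) (a `\ v)).
  have [[w [wa wv vw]]|allk] := classic (exists w, [/\ w \in a, w != v & color G v w != k]).
    apply: (star_cut ha wa ka) => u ua uw; have [->|uv] := eqVneq u v.
      by rewrite symC.
    apply: contraNneq knew => <-; apply: (mem_colors ha); rewrite // ?inE ?wv ?uv //.
    by rewrite eq_sym.
  have vk w : w \in a -> w != v -> color G v w = k.
    by move=> wa wv; apply/eqP/negPn/negP => vw; apply: allk; exists w.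
  have [|k2 k2a] := @colors_notin a [fset k]; first by rewrite cardfs1; lia.
  rewrite inE => k2k; apply: (star_cut ha va k2a) => w wa wv.
  by rewrite vk // eq_sym.
have sub : colors G a a `<=` colors G (a `\ v) (a `\ v).
  by apply/fsubsetP => k ka; apply/negPn/negP => nk; apply: nonew; exists k.
have col3' := leq_trans col3 (fsubset_leq_card sub).
have a'0 : a `\ v != fset0.
  have [|k ka _] := @colors_notin a fset0; first by rewrite cardfs0; lia.
  have /colorsP[x [y [xa' _ _ _]]] := fsubsetP sub k ka.
  by apply/fset0Pn; exists x.
have ha' := sub_clique ha a'a a'0; have ra' := sub_rainbow_free a'a ra.
have [|k1 [X [k1a' X0 Xa' cutX]]] := IHn _ _ ha' ra' col3'; first by lia.
have [P [pP homP P1 nk1]] := cut_partition ha' ra' X0 Xa' cutX.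
have k1a : k1 \in colors G a a.
  by have /colorsP[x [y [xa ya xy ek]]] := k1a'; apply/colorsP; exists x, y; rewrite !sub'.
have blkS b x : b \in P -> x \in b -> x \in a /\ x != v.
  move=> bP xb; have := fsubsetP (fpartition_sub pP bP) x xb.
  by rewrite !inE => /andP[].
(* A component [B] with no edge of color [k1] to [v] remains cut off in [a]; otherwise every
   component has such an edge. *)
have [[B [BP vB]]|nB] := classic (exists B, B \in P /\
    forall x, x \in B -> color G v x != k1).
  exists k1, B; split => //.
  - by apply/fset0Pn; apply: fpartition_neq0 pP BP.
  - rewrite fproperE (fsubset_trans (fpartition_sub pP BP)) //=.
    by apply/fsubsetPn; exists v => //; apply/negP => /(blkS B v BP)[_]; rewrite eqxx.
  - move=> x y xB ya yB; have [xa xv] := blkS _ _ BP xB.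
    have [->|yv] := eqVneq y v; first by rewrite symC ?vB.
    have ya' : y \in a `\ v by rewrite !inE yv.
    have [c cP yc] := fpartition_cover pP ya'.
    by apply: (nk1 B c) => //; apply: contraNneq yB => ->.
have vB B : B \in P -> exists2 x, x \in B & color G v x = k1.
  move=> BP; apply: NNPP => nex; apply: nB; exists B; split=> // x xB.
  by apply/eqP => vx; apply: nex; exists x.
(* A color absent at [v] isolates [v], so every color may now be assumed to occur at [v]. *)
have [[k [ka kv]]|nostar] := classic (exists k, k \in colors G a a /\
    forall w, w \in a -> w != v -> color G v w != k).
  exact: star_cut ka kv.
have vcol k : k \in colors G a a -> exists b w, [/\ b \in P, w \in b & color G v w = k].
  move=> ka; apply: NNPP => nex; apply: nostar; exists k; split=> // w wa wv.
  have [|b bP wb] := fpartition_cover pP (x := w); first by rewrite !inE wv.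
  by apply/eqP => vw; apply: nex; exists b, w.
(* Take [z] in [c] such that [vz] has color [k1]. The edge [wz] joins two components, so its color
   is not [k1]; the triangle on [w], [v], [z] then forces it to be [k], and homogeneity spreads [k]
   to all edges between [b] and [c]. *)
have joined k b w c x y : k != k1 -> b \in P -> w \in b -> color G v w = k ->
    c \in P -> b != c -> x \in b -> y \in c -> color G x y = k.
  move=> kk1 bP wb vw cP bc xb yc; have [z zc vz] := vB c cP.
  have [wa wv] := blkS _ _ bP wb; have [za zv] := blkS _ _ cP zc.
  have wz : w != z.
    apply: contraNneq bc => e; apply/eqP; apply: (fpartition_block_eq pP bP cP wb).
    by rewrite e.
  rewrite (homP b c bP cP bc x y xb yc w z wb zc); apply/eqP/negPn/negP => nk.
  have : color G w v = color G v z.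
    apply: (rainbow_freeE ha ra); rewrite // 1?eq_sym // eq_sym.
      by rewrite (symC w v) // vw.
    by rewrite vz; apply: (nk1 b c).
  by rewrite symC // vw vz => e; rewrite e eqxx in kk1.
have [|k2 k2a] := @colors_notin a [fset k1]; first by rewrite cardfs1; lia.
rewrite inE => k21.
have [|k3 k3a] := @colors_notin a [fset k1; k2]; first by rewrite cardfs2; lia.
rewrite !inE negb_or => /andP[k31 k32].
have [b2 [w2 [b2P w2b vw2]]] := vcol k2 k2a.
have [b3 [w3 [b3P w3b vw3]]] := vcol k3 k3a.
have J2 := joined k2 b2 w2 _ _ _ k21 b2P w2b vw2.
have J3 := joined k3 b3 w3 _ _ _ k31 b3P w3b vw3.
(* Edges from [b2] to other blocks have color [k2], those from [b3] have color [k3]. One edge of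
   both kinds identifies the colors: an edge to a further block if [b2] and [b3] coincide, an edge
   between them otherwise. *)
case/eqP: k32; have [e|ne] := eqVneq b3 b2.
  have [c cP bc] := exists_other_block P1 b2P; have [z zc] := fpartition_neq0 pP cP.
  by rewrite -(J2 c w2 z) // -(J3 c w2 z) ?e.
have [w2a _] := blkS _ _ b2P w2b; have [w3a _] := blkS _ _ b3P w3b.
by rewrite -(J3 b2 w3 w2) // -(J2 b3 w2 w3) 1?eq_sym // symC.
Qed.

(** Minimality of the number of blocks stays in the conclusion because the irreducibility of the
    tree factors rests on it. *)
Lemma gallai_partition a : is_clique G a -> rainbow_free G a ->
  (1 < #|` a|)%N ->
  exists P, [/\ is_partition P a, (1 < #|` P|)%N, homogeneous G P,
    two_partition G P &
    forall Q, is_partition Q a -> (1 < #|` Q|)%N -> homogeneous G Q ->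
      (#|` P| <= #|` Q|)%N].
Proof.
move=> ha ra a1.
pose A P := [/\ is_partition P a, (1 < #|` P|)%N & homogeneous G P].
have [|P [[pP P1 homP] minP]] := @ex_minimal _ A (fun P => #|` P|).
  exists (singletons a); split; last exact: singletons_homogeneous.
    exact: singletons_partition.
  by rewrite card_singletons.
exists P; split => // [|Q pQ Q1 homQ]; last exact: minP.
have [x0 x0a] : exists x, x \in a by apply/fset0Pn; case: ha.
have [rep repP] := @finite_choice _ _ (fun (b : {fset V}) x => x \in b) x0 P
  (fun b bP => fpartition_neq0 pP bP).
rewrite /two_partition leqNgt; apply/negP => col3.
have repa b : b \in P -> rep b \in a.
  by move=> bP; apply: (fsubsetP (fpartition_sub pP bP)); apply: repP.
pose r := [fset rep b | b in P].
have rP x : x \in r -> exists2 b, b \in P & x = rep b by move=> /imfsetP.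
have rep_r b : b \in P -> rep b \in r by move=> bP; apply/imfsetP; exists b.
have rep_inj b c : b \in P -> c \in P -> rep b = rep c -> b = c.
  move=> bP cP e; apply: (fpartition_block_eq pP bP cP (repP b bP)).
  by rewrite e; apply: repP.
have ra' : r `<=` a by apply/fsubsetP => x /rP[b bP ->]; apply: repa.
have card_r : #|` r| = #|` P| by rewrite card_in_imfset.
have r0 : r != fset0 by rewrite -cardfs_gt0 card_r; lia.
have hr := sub_clique ha ra' r0; have rr := sub_rainbow_free ra' ra.
(* By homogeneity the transversal [r] already shows every color that occurs between blocks. *)
have sub : partition_colors G P `<=` colors G r r.
  apply/fsubsetP => k /partition_colorsP[b [c [x [y [bP cP bc [xb yc _ ->]]]]]].
  rewrite (homP b c bP cP bc x y xb yc (rep b) (rep c)) ?repP //.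
  apply: (mem_colors hr); rewrite ?rep_r //.
  by apply: contraNneq bc => /rep_inj->.
have [k [X [kr X0 Xr cutX]]] :=
  rainbow_free_cut hr rr (leq_trans col3 (fsubset_leq_card sub)).
have [Q [pQ homQ Q1 nkQ]] := cut_partition hr rr X0 Xr cutX.
(* The color [k] occurs in [r] but not between distinct blocks of [Q], so some block of [Q] has at
   least two vertices. *)
have Qr : (#|` Q| < #|` r|)%N.
  have /colorsP[x [y [xr yr xy ek]]] := kr.
  have [b bQ xb] := fpartition_cover pQ xr; have [c cQ yc] := fpartition_cover pQ yr.
  have [e|bc] := eqVneq b c; last by have := nkQ b c x y bQ cQ bc xb yc; rewrite ek eqxx.
  apply: (card_partition_lt pQ bQ); rewrite -e in yc.
  have nxy : y != x by apply: contraTneq xy => ->; rewrite edge_irr.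
  by rewrite (cardfsD1 x) xb (cardfsD1 y) !inE nxy yc.
(* [rho] sends a representative back to its block, so that [Q] can be lifted from [r] to [a]. *)
have [rho rhoP] := @finite_choice _ _ (fun x b => b \in P /\ x = rep b) fset0 r
  (fun x xr => let: ex_intro2 b bP e := rP x xr in ex_intro _ b (conj bP e)).
have [||||Q' [pQ' homQ' cQ']] :=
    @homogeneous_merge _ G r rho a Q _ _ _ _ pQ homQ.
- move=> x /rhoP[bP _]; split; first exact: (fpartition_sub pP).
  exact: fpartition_neq0 pP bP.
- move=> x /(fpartition_cover pP)[b bP xb]; exists (rep b); first exact: rep_r.
  by have [b'P e] := rhoP _ (rep_r b bP); rewrite (rep_inj _ _ b'P bP (esym e)).
- move=> x y z /rhoP[bP ex] /rhoP[cP ey] zb zc.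
  by rewrite [LHS]ex [RHS]ey (fpartition_block_eq pP bP cP zb zc).
- move=> x y u w /rhoP[bP ex] /rhoP[cP ey] xy ub wc.
  rewrite [in RHS]ex [in RHS]ey; apply: (homP (rho x) (rho y)); rewrite ?repP //.
  by apply: contraNneq xy => e; rewrite ex ey e.
have := minP Q'; rewrite cQ' => /(_ (And3 pQ' _ homQ')).
by rewrite cQ' => /(_ Q1); rewrite -card_r leqNgt Qr.
Qed.

Lemma rainbow_free_hereditary a : is_clique G a -> rainbow_free G a ->
  hereditary_two_clique G a.
Proof.
have [n] := ubnP #|` a|; elim: n a => // n IHn a lta ha ra.
have [a1|a1] := leqP #|` a| 1.
  have : #|` a| == 1%N by rewrite eqn_leq a1 cardfs_gt0; case: ha.
  by move=> /cardfs1P[x ->]; apply: Hereditary1.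
have [P [pP P1 homP twoP _]] := gallai_partition ha ra a1.
apply: (HereditaryPartition ha pP twoP homP) => b bP.
have ba := fpartition_block_proper pP P1 bP.
have lt := fproper_ltn_card ba; have ba' := fproper_sub ba.
apply: IHn; [by lia | | exact: sub_rainbow_free ba' ra].
by apply: sub_clique ha ba' _; apply/fset0Pn; apply: fpartition_neq0 pP bP.
Qed.

End Partition.

(** * Leaf graphs of trees have no rainbow triangle *)

Section TreeColors.
Import Order.TTheory.
Local Open Scope order_scope.
Variables (d : Order.disp_t) (T : finPOrderType d).
Implicit Types (p q s t u v : T).

Lemma child_comparable_eq p u v : child u p -> child v p -> u >=< v -> u = v.
Proof.
move=> /andP[up nup] /andP[vp nvp]; case: comparableP => // [uv|vu] _.
  by case/existsP: nup; exists v; rewrite uv.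
by case/existsP: nvp; exists u; rewrite vu.
Qed.

Lemma tree_comparable s u v : is_tree T -> s <= u -> s <= v -> u >=< v.
Proof.
move=> treeT su sv; apply/negPn/negP => inc.
by have [_ []] := treeT u v inc; exists s.
Qed.

(** Elements above [s] form a chain, and [p] cannot lie strictly between [u] and its parent [q]. *)
Lemma child_le_parent p q s u : is_tree T ->
  s <= u -> s <= p -> child u q -> p < q -> p <= u.
Proof.
move=> treeT su sp /andP[uq nuq] pq.
have := tree_comparable treeT sp su; case: comparableP => // up _.
by case/existsP: nuq; exists p; rewrite up.
Qed.

Lemma siblingP u v :
  reflect (u != v /\ exists p, child u p /\ child v p) (sibling u v).
Proof.
apply: (iffP andP) => [[inc /existsP[p /andP[up vp]]]|[uv [p [up vp]]]].
  split; last by exists p.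
  by apply: contraNneq inc => ->; apply: comparablexx.
split; last by apply/existsP; exists p; rewrite up.
by apply: contraNN uv => /(child_comparable_eq up vp)->.
Qed.

Variables (C : choiceType) (S : ecgraph T C).
Hypotheses (treeT : is_tree T) (sibS : sibling_coloring S)
  (twoS : two_coloring S).

(** Let [s], [t] separate below [p] and [s], [r] below [p']; both lie above [s], hence are
    comparable. If [p < p'], then [r] separates from [s] and from [t] at the same siblings; if
    [p' < p], the same holds for [t] against [s] and [r]. *)
Lemma leaf_color_not_rainbow s t r : leaf s -> leaf t -> leaf r ->
  s != t -> t != r -> s != r ->
  ~~ uniq [:: leaf_color S s t; leaf_color S t r; leaf_color S s r].
Proof.
move=> ls lt lr st tr sr.
have [u [v [sib su tv]]] := sibling_above_exists treeT ls lt st.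
have [u' [r' [sib' su' rr']]] := sibling_above_exists treeT ls lr sr.
have est := leaf_colorE S treeT sib su tv.
have esr := leaf_colorE S treeT sib' su' rr'.
have /siblingP[uv [p [up vp]]] := sib.
have /siblingP[ur' [p' [up' rp']]] := sib'.
have lt_child x q : child x q -> x < q by case/andP.
have sp : s <= p := le_trans su (ltW (lt_child _ _ up)).
have sp' : s <= p' := le_trans su' (ltW (lt_child _ _ up')).
have := tree_comparable treeT sp sp'; case: comparableP => // [pp'|p'p|epp'] _.
- have pu' := child_le_parent treeT su' sp up' pp'.
  have tu' : t <= u' := le_trans tv (le_trans (ltW (lt_child _ _ vp)) pu').
  by rewrite (leaf_colorE S treeT sib' tu' rr') esr /= !inE eqxx andbF.
- have p'u := child_le_parent treeT su sp' up p'p.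
  have ru : r <= u := le_trans rr' (le_trans (ltW (lt_child _ _ rp')) p'u).
  have sibvu : sibling v u by apply/siblingP; rewrite eq_sym; split=> //; exists p.
  rewrite (leaf_colorE S treeT sibvu tv ru) est (color_sym (u := v)).
    by rewrite /= !inE eqxx.
  by rewrite sibS.
(* Both [u] and [u'] are now children of [p] above [s], hence equal. Either [t] and [r] lie below
   the same child, or three distinct children of [p] share at most two colors. *)
- rewrite -epp' in up' rp'.
  have eu := child_comparable_eq up' up (tree_comparable treeT su' su).
  rewrite eu in esr ur' sib'.
  have [e|vr'] := eqVneq v r'; first by rewrite est esr e /= !inE eqxx orbT.
  have sibvr : sibling v r' by apply/siblingP; split=> //; exists p.
  have etr := leaf_colorE S treeT sibvr tv rr'.
  have nlp : ~~ leaf p.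
    by apply/negP => /eqP e; have := in_fset0 u; rewrite -e !inE up.
  apply: (card_no_rainbow (twoS nlp)); rewrite ?est ?esr ?etr;
    apply/colorsP; [exists u, v | exists v, r' | exists u, r'];
    by rewrite !inE sibS.
Qed.

Lemma leaf_graph_rainbow_free (V : choiceType) (G : ecgraph V C) (a : {fset V})
  (f : V -> T) : leaf_graph_iso S G a f -> rainbow_free G a.
Proof.
case=> inj_f im_f col_f x y z xa ya za xy yz xz.
have lf w : w \in a -> leaf (f w).
  move=> wa; have : f w \in [fset t : T | leaf t] by rewrite -im_f; apply: in_imfset.
  by rewrite !inE.
have nf (x1 x2 : V) : x1 \in a -> x2 \in a -> x1 != x2 -> f x1 != f x2.
  by move=> x1a x2a; apply: contra_neq; apply: inj_f.
by rewrite !col_f //; apply: leaf_color_not_rainbow; rewrite ?lf ?nf.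
Qed.

End TreeColors.

Lemma tree_two_clique_rainbow_free (V C : choiceType) (G : ecgraph V C)
  (a : {fset V}) : tree_two_clique G a -> rainbow_free G a.
Proof.
move=> [d [T [S [f [treeT sibS twoS iso]]]]].
exact: leaf_graph_rainbow_free iso.
Qed.

(** * The laminar family of iterated Gallai partitions *)

Section Construction.
Variables (V C : choiceType) (G : ecgraph V C).
Implicit Types (a b x y : {fset V}) (P Q F : {fset {fset V}}).

Definition gallai_decomposition P a :=
  [/\ is_partition P a, (1 < #|` P|)%N, homogeneous G P, two_partition G P &
    forall Q, is_partition Q a -> (1 < #|` Q|)%N -> homogeneous G Q ->
      (#|` P| <= #|` Q|)%N].

(** The members serve as the nodes of the tree. The last clause of [family_node] makes the blocks of
    [P] the maximal members properly inside [x], that is, its children under inclusion. *)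
Record decomposition_family F a : Prop := DecompositionFamily {
  family_root : a \in F;
  family_sub : forall x, x \in F -> x `<=` a /\ exists v, v \in x;
  family_singleton : forall v, v \in a -> [fset v] \in F;
  family_laminar : forall x y v, x \in F -> y \in F -> v \in x -> v \in y ->
    x `<=` y \/ y `<=` x;
  family_node : forall x, x \in F -> (1 < #|` x|)%N -> exists P,
    [/\ P `<=` F, gallai_decomposition P x &
        forall y, y \in F -> y `<` x -> exists2 b, b \in P & y `<=` b] }.

(** The family consists of [a] and the families of the blocks of a Gallai partition. Members from
    different blocks are disjoint, so laminarity reduces to a single block. *)
Lemma decomposition_family_exists a : is_clique G a -> rainbow_free G a ->
  exists F, decomposition_family F a.
Proof.
have [n] := ubnP #|` a|; elim: n a => // n IHn a lta ha ra.
have [x0 x0a] : exists v, v \in a by apply/fset0Pn; case: ha.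
have [a1|a1] := leqP #|` a| 1.
  have /cardfs1P[x ea] : #|` a| == 1%N by rewrite eqn_leq a1 cardfs_gt0; case: ha.
  exists [fset a]; split.
  - by rewrite inE.
  - by move=> y /fset1P->; split=> //; exists x0.
  - by move=> v; rewrite ea => /fset1P->; rewrite inE.
  - by move=> y z v /fset1P-> /fset1P->; left.
  - by move=> y /fset1P->; rewrite ltnNge a1.
have [P dP] := gallai_partition ha ra a1; have [pP P1 homP twoP minP] := dP.
have [b bP|g gP] := @finite_choice _ _ (fun b F => decomposition_family F b) fset0 P.
  have ba := fpartition_block_proper pP P1 bP.
  have lt := fproper_ltn_card ba; have ba' := fproper_sub ba.
  apply: IHn; [by lia | | exact: sub_rainbow_free ba' ra].
  by apply: sub_clique ha ba' _; apply/fset0Pn; apply: fpartition_neq0 pP bP.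
pose F := a |` \bigcup_(b <- P) g b.
have FP x : reflect (x = a \/ exists2 b, b \in P & x \in g b) (x \in F).
  apply: (iffP idP) => [/fset1UP[->|/bigfcupP[b /andP[bP _] xb]]|[->|[b bP xb]]].
  - by left.
  - by right; exists b.
  - exact: fset1U1.
  - by apply/fset1UP; right; apply/bigfcupP; exists b; rewrite ?bP.
have gsub b x : b \in P -> x \in g b -> x `<=` b /\ exists v, v \in x.
  by move=> bP; apply: (family_sub (gP b bP)).
have bsub b : b \in P -> b `<=` a by apply: fpartition_sub pP.
have gF b x : b \in P -> x \in g b -> x \in F by move=> bP xb; apply/FP; right; exists b.
have geq b c x y v : b \in P -> c \in P -> x \in g b -> y \in g c ->
    v \in x -> v \in y -> b = c.
  move=> bP cP xb yc vx vy; have [/fsubsetP xb' _] := gsub b x bP xb.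
  have [/fsubsetP yc' _] := gsub c y cP yc.
  exact: (fpartition_block_eq pP bP cP (xb' v vx) (yc' v vy)).
exists F; split.
- by apply/FP; left.
- move=> x /FP[->|[b bP xb]]; first by split=> //; exists x0.
  by have [xb' ex] := gsub b x bP xb; split=> //; apply: fsubset_trans xb' (bsub b bP).
- move=> v va; have [b bP vb] := fpartition_cover pP va.
  by apply: (gF b) => //; apply: (family_singleton (gP b bP)).
- move=> x y v /FP[->|[b bP xb]] /FP[->|[c cP yc]] vx vy; first by left.
  + by right; have [yc' _] := gsub c y cP yc; apply: fsubset_trans yc' (bsub c cP).
  + by left; have [xb' _] := gsub b x bP xb; apply: fsubset_trans xb' (bsub b bP).
  have e := geq b c x y v bP cP xb yc vx vy; rewrite -e in yc.
  exact: (family_laminar (gP b bP) xb yc vx vy).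
- move=> x /FP[->{x} _|[b bP xb] x1].
    exists P; split=> //.
      by apply/fsubsetP => b bP; apply: (gF b) => //; apply: (family_root (gP b bP)).
    move=> y /FP[->|[b bP yb] _]; first by rewrite fproperEneq eqxx.
    by exists b => //; case: (gsub b y bP yb).
  have [Q [QF dQ maxQ]] := family_node (gP b bP) xb x1; exists Q; split=> //.
    by apply/fsubsetP => c cQ; apply: (gF b) => //; apply: (fsubsetP QF).
  (* A nonempty member inside [x] shares a vertex with it, hence belongs to the family of the same
     block. *)
  move=> y /FP[->|[c cP yc]] yx; last first.
    apply: maxQ => //; have [_ [v vy]] := gsub c y cP yc.
    by rewrite (geq b c x y v bP cP xb yc) // (fsubsetP (fproper_sub yx)).
  have [xb' _] := gsub b x bP xb.
  have := fproper_sub_trans yx (fsubset_trans xb' (bsub b bP)).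
  by rewrite fproperEneq eqxx.
Qed.

End Construction.

(** * The tree of a decomposition family, ordered by inclusion *)

Definition node (V : choiceType) (F : {fset {fset V}}) : Type := F.

HB.instance Definition _ (V : choiceType) (F : {fset {fset V}}) :=
  SubFinite.on (node F).

Definition node_le (V : choiceType) (F : {fset {fset V}}) : rel (node F) :=
  fun x y => val x `<=` val y.

Fact node_le_refl V F : reflexive (@node_le V F).
Proof. by move=> x; apply: fsubset_refl. Qed.

Fact node_le_anti V F : antisymmetric (@node_le V F).
Proof. by move=> x y xy; apply: val_inj; apply/eqP; rewrite eqEfsubset. Qed.

Fact node_le_trans V F : transitive (@node_le V F).
Proof. by move=> y x z; apply: fsubset_trans. Qed.

Fact node_display : Order.disp_t.
Proof. exact: Order.Disp tt tt. Qed.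

HB.instance Definition _ (V : choiceType) (F : {fset {fset V}}) :=
  Order.Le_isPOrder.Build node_display (node F)
    (@node_le_refl V F) (@node_le_anti V F) (@node_le_trans V F).
Section FamilyTree.
Variables (V C : choiceType) (G : ecgraph V C) (a : {fset V}).
Variable F : {fset {fset V}}.
Hypotheses (ha : is_clique G a) (dF : decomposition_family G F a).
Implicit Types (s t : node F) (P Q : {fset {fset V}}).

Lemma node_ltE s t : (s < t)%O = (val s `<` val t).
Proof. by rewrite Order.POrderTheory.lt_neqAle fproperEneq. Qed.

Lemma node_neq0 t : exists v, v \in val t.
Proof. by case: (family_sub dF (valP t)). Qed.

Lemma node_sub t : val t `<=` a.
Proof. by case: (family_sub dF (valP t)). Qed.

(** The root is a common upper bound. A common lower bound contains a vertex, and laminarity then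
    makes the two nodes comparable. *)
Lemma node_tree : is_tree (node F).
Proof.
move=> s t inc; split.
  by exists (Sub a (family_root dF) : node F); split; apply: node_sub.
move=> [w [ws wt]]; have [v vw] := node_neq0 w; case/negP: inc.
have vs := fsubsetP ws v vw; have vt := fsubsetP wt v vw.
by apply/orP; case: (family_laminar dF (valP s) (valP t) vs vt); [left | right].
Qed.

Lemma node_singleton v : v \in a -> exists t, val t = [fset v].
Proof. by move=> /(family_singleton dF) vF; exists (Sub [fset v] vF : node F). Qed.

(** Every node contains a singleton node, so the minimal nodes are the singletons. *)
Lemma node_leafP t : reflect (exists v, val t = [fset v]) (leaf t).
Proof.
apply: (iffP (leafP t)) => [min_t|[v et] s].
  have [v vt] := node_neq0 t; exists v.
  have [s es] := node_singleton (fsubsetP (node_sub t) v vt).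
  by rewrite -(min_t s) // /Order.le /= /node_le es fsub1set.
rewrite /Order.le /= /node_le et fsubset1 => /orP[/eqP es|/eqP es].
  by apply: val_inj; rewrite es et.
by have [w] := node_neq0 s; rewrite es.
Qed.

(** A child lies in some block, itself a node below [t], hence equals it. Conversely, a node
    strictly between a block and [t] would lie in a block meeting, hence equal to, the first one. *)
Lemma node_children t : ~~ leaf t -> exists2 P, gallai_decomposition G P (val t) &
  P `<=` F /\ forall s, child s t = (val s \in P).
Proof.
move=> nlt; have t1 : (1 < #|` val t|)%N.
  have [v vt] := node_neq0 t; rewrite ltn_neqAle cardfs_gt0 andbC.
  apply/andP; split; first by apply/fset0Pn; exists v.
  by rewrite eq_sym; apply: contraNN nlt => /cardfs1P[w et]; apply/node_leafP; exists w.
have [P [PF dP maxP]] := family_node dF (valP t) t1; exists P => //; split=> // s.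
have [pP P1 _ _ _] := dP.
have proper b (bP : b \in P) : b `<` val t by apply: fpartition_block_proper pP P1 bP.
apply/idP/idP => [/andP[st nst]|sP].
  rewrite node_ltE in st; have [b bP sb] := maxP (val s) (valP s) st.
  have [->//|ne] := eqVneq (val s) b; case/existsP: nst.
  exists (Sub b (fsubsetP PF b bP) : node F).
  by rewrite !node_ltE SubK fproperEneq ne sb proper.
apply/andP; split; first by rewrite node_ltE proper.
apply/existsPn => u; rewrite !node_ltE; apply/negP => /andP[su ut].
have [b bP ub] := maxP (val u) (valP u) ut; have [v vs] := node_neq0 s.
have sb := fproper_sub_trans su ub.
have e := fpartition_block_eq pP sP bP vs (fsubsetP (fproper_sub sb) v vs).
by rewrite e fproperEneq eqxx in sb.
Qed.

Definition rep t : V := xchoose (node_neq0 t).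

Lemma mem_rep t : rep t \in val t.
Proof. exact: xchooseP. Qed.

Lemma rep_in_clique t : rep t \in a.
Proof. exact: (fsubsetP (node_sub t) _ (mem_rep t)). Qed.

Lemma node_sibling_irr : irreflexive (@sibling _ (node F)).
Proof. by move=> t; apply/siblingP => -[]; rewrite eqxx. Qed.

Lemma node_sibling_sym : symmetric (@sibling _ (node F)).
Proof.
suff imp s t : sibling s t -> sibling t s by move=> s t; apply/idP/idP; apply: imp.
move=> /siblingP[st [p [sp tp]]]; apply/siblingP; rewrite eq_sym; split=> //.
by exists p.
Qed.

Lemma node_color_sym s t :
  sibling s t -> color G (rep s) (rep t) = color G (rep t) (rep s).
Proof. by move=> _; apply: (clique_colorC ha); apply: rep_in_clique. Qed.

(** Siblings take the color of an edge between representatives; homogeneity makes the choice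
    immaterial, by [node_graph_color]. *)
Definition node_graph : ecgraph (node F) C :=
  @ECGraph (node F) C (@sibling _ (node F)) (fun s t => color G (rep s) (rep t))
    node_sibling_irr node_sibling_sym node_color_sym.

Lemma node_graph_color p s t x y : child s p -> child t p -> s != t ->
  x \in val s -> y \in val t -> color G x y = color node_graph s t.
Proof.
move=> sp tp st xs yt; have nlp : ~~ leaf p.
  by apply/negP => /eqP e; have := in_fset0 s; rewrite -e !inE sp.
have [P [pP _ homP _ _] [_ chP]] := node_children nlp.
rewrite chP in sp; rewrite chP in tp.
exact: (homP _ _ sp tp st x y xs yt _ _ (mem_rep s) (mem_rep t)).
Qed.

Lemma node_graph_two_coloring : two_coloring node_graph.
Proof.
move=> t nlt; have [P [pP _ _ twoP _] [_ chP]] := node_children nlt.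
apply: leq_trans (fsubset_leq_card _) twoP; apply/fsubsetP => k.
move=> /colorsP[u [v []]]; rewrite !inE /= !chP => uP vP /siblingP[uv _] ->.
apply/partition_colorsP; exists (val u), (val v), (rep u), (rep v).
have uv' : val u != val v by apply: contra_neq uv; apply: val_inj.
split=> //; split; rewrite ?mem_rep //; apply: ha.2; rewrite ?rep_in_clique //.
apply: contraNneq uv' => e; apply/eqP.
by apply: (fpartition_block_eq pP uP vP (mem_rep u)); rewrite e mem_rep.
Qed.

(** A nontrivial homogeneous partition of the children would merge blocks of the Gallai partition of
    [val t] into a homogeneous one with fewer blocks, against minimality. *)
Lemma node_graph_irreducible t : ~~ leaf t -> irreducible node_graph (children t).
Proof.
move=> nlt Q pQ [Q1 [q qQ nq1]] homQ.
have [P [pP _ _ _ minP] [PF chP]] := node_children nlt.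
have memK s : (s \in children t) = (val s \in P) by rewrite !inE chP.
have [||||Q' [pQ' homQ' cQ']] :=
    @homogeneous_merge _ _ G _ node_graph (children t) val (val t) Q _ _ _ _ pQ homQ.
- move=> s; rewrite memK => /(fpartition_sub pP) ->; split=> //; exact: node_neq0.
- move=> x /(fpartition_cover pP)[b bP xb].
  by exists (Sub b (fsubsetP PF b bP) : node F); rewrite ?memK SubK.
- move=> s u x; rewrite !memK => sP uP xs xu; apply: val_inj.
  exact: fpartition_block_eq pP sP uP xs xu.
- move=> s u x y; rewrite !inE /= => sP uP; exact: node_graph_color sP uP.
have := minP Q' pQ'; rewrite cQ' => /(_ Q1 homQ'); rewrite leqNgt => /negP; apply.
have q1 : (1 < #|` q|)%N.
  rewrite ltn_neqAle eq_sym nq1 cardfs_gt0; apply/fset0Pn.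
  exact: fpartition_neq0 pQ qQ.
apply: leq_trans (card_partition_lt pQ qQ q1) _.
have <- : #|` [fset val s | s in children t]| = #|` children t|.
  by rewrite card_imfset //; apply: val_inj.
apply: fsubset_leq_card.
by apply/fsubsetP => _ /imfsetP[s + ->]; rewrite /= memK.
Qed.

Lemma node_graph_iso : exists f : V -> node F, leaf_graph_iso node_graph G a f.
Proof.
(* [root] is only the default value of [f] outside [a]; on [a], [f] sends a vertex to its
   singleton. *)
have [root _] : exists t : node F, val t = a.
  by exists (Sub a (family_root dF) : node F).
pose f v : node F := insubd root [fset v].
have fE v : v \in a -> val (f v) = [fset v].
  by move=> va; rewrite /f insubdK //; apply: (family_singleton dF).
exists f; split.
- move=> x y xa ya e; apply: fset1_inj; by rewrite -!fE // e.
- apply/fsetP => t; rewrite !inE; apply/imfsetP/node_leafP => [[v va ->]|[v et]].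
    by exists v; rewrite fE.
  have va : v \in a by rewrite -fsub1set -et; apply: node_sub.
  by exists v => //; apply: val_inj; rewrite fE.
move=> x y xa ya xy.
have lf v : v \in a -> leaf (f v) by move=> va; apply/node_leafP; exists v; apply: fE.
have fxy : f x != f y.
  by apply: contraNneq xy => e; apply/eqP/fset1_inj; rewrite -!fE // e.
have [u [v [sib xu yv]]] := sibling_above_exists node_tree (lf x xa) (lf y ya) fxy.
rewrite (leaf_colorE node_graph node_tree sib xu yv).
have /siblingP[uv [p [up vp]]] := sib.
apply: (node_graph_color up vp uv).
  by have := fsubsetP xu x; rewrite fE // inE; apply.
by have := fsubsetP yv y; rewrite fE // inE; apply.
Qed.

End FamilyTree.

Lemma rainbow_free_hereditarily_irreducible (V C : choiceType) (G : ecgraph V C)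
  (a : {fset V}) : is_clique G a -> rainbow_free G a ->
  hereditarily_irreducible_two_clique G a.
Proof.
move=> ha ra; have [F dF] := decomposition_family_exists ha ra.
have [f iso] := node_graph_iso ha dF.
exists node_display, (node F), (node_graph ha dF), f.
split; last exact: node_graph_irreducible.
split=> //; [exact: node_tree dF | exact: node_graph_two_coloring].
Qed.

Theorem theorem4 (V C : choiceType) (G : ecgraph V C) (a : {fset V})
  (ha : is_clique G a) :
  [<-> gallai G a;
       no_colorful_cycle G a;
       hereditary_two_clique G a;
       hereditarily_irreducible_two_clique G a;
       tree_two_clique G a;
       forall b c : {fset V}, subclique b a -> subclique c a ->
         [disjoint b & c] ->
         (#|` colors G b c `\` colors G b b| <= #|` c|)%N;
       forall b : {fset V}, subclique b a ->
         (#|` colors G b b| <= #|` b| - 1)%N].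
Proof.
(* The implications form one cycle in the listed order. The passage to tree 2-cliques forgets
   irreducibility, that between the two counting conditions is direct, and all others go through
   [rainbow_free]. *)
tfae.
- by move=> /(gallaiP ha); apply: rainbow_free_no_colorful_cycle.
- move=> nc; apply: (rainbow_free_hereditary ha); apply/(gallaiP ha) => s sa cs _.
  exact: nc.
- by move=> /hereditary_rainbow_free; apply: rainbow_free_hereditarily_irreducible.
- by move=> [d [T [S [f [tT _]]]]]; exists d, T, S, f.
- move=> /tree_two_clique_rainbow_free ra b c [_ ba] [_ ca].
  exact: rainbow_free_outer_colors ra ba ca.
- exact: card_colors_of_outer.
- by move=> H; apply/(gallaiP ha); apply: rainbow_free_of_card_colors.
Qed.
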